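(* Let $X_1, X_2, \dots$ be independent identically distributed random variables taking positive integer values, with finite $\frac12$-moment, i.e. $E\left[X_1^{1/2}\right]<\infty$. Let $W_n=\sum_{i=1}^n X_i$ for $n\ge 1$, so that $X_{i+1}=W_{i+1}-W_i$ for all $i \geq 1$. Then with probability $1$ the sequence $W_1, W_2, \dots$ is asymptotically complete.
   Context: A non-decreasing sequence of positive integers $a_1\le a_2\le \dots$ with $d=\gcd(a_1,a_2,\dots)$ is called asymptotically complete if every large enough multiple of $d$ can be written as a sum of index-distinct terms of the sequence; that is, there is a positive integer $n_0$ such that for every integer $n\ge n_0$ there is a finite set $F$ of indices with $nd=\sum_{i\in F}a_i$. *)

(* Defs.v *)
From HB Require Import structures.
From mathcomp Require Import all_boot all_order all_algebra finmap.
From mathcomp Require Import all_classical all_reals all_analysis.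

Set Implicit Arguments.
Unset Strict Implicit.
Unset Printing Implicit Defensive.

Import Order.TTheory GRing.Theory Num.Theory.

Local Open Scope classical_set_scope.
Local Open Scope ring_scope.

(* Sequences are indexed from 0: [a n] stands for a_(n+1). *)

Definition is_seq_gcd (a : nat -> nat) (d : nat) : Prop :=
  (forall i, (d %| a i)%N) /\
  (forall e, (forall i, (e %| a i)%N) -> (e %| d)%N).

Definition asymptotically_complete (a : nat -> nat) : Prop :=
  [/\ forall i j, (i <= j)%N -> (a i <= a j)%N,
      forall i, (0 < a i)%N
    & exists2 d : nat, is_seq_gcd a d &
        exists2 n0 : nat, (0 < n0)%N &
          forall n, (n0 <= n)%N ->
            exists F : {fset nat}, (n * d = \sum_(i <- F) a i)%N].

Definition mutually_independent (d d' : measure_display)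
    (T : measurableType d) (T' : measurableType d') (R : realType)
    (P : probability T R) (X : nat -> {RV P >-> T'}) : Prop :=
  forall (J : {fset nat}) (B : nat -> set T'), (forall j, measurable (B j)) ->
    P (\bigcap_(j in [set` J]) (X j @^-1` B j)) =
    (\prod_(j <- J) P (X j @^-1` B j))%E.

Definition identically_distributed (d d' : measure_display)
    (T : measurableType d) (T' : measurableType d') (R : realType)
    (P : probability T R) (X : nat -> {RV P >-> T'}) : Prop :=
  forall (i j : nat) (B : set T'), measurable B ->
    distribution P (X i) B = distribution P (X j) B.

Definition partial_sum (T : Type) (X : nat -> T -> nat) (n : nat) (w : T) : nat :=
  (\sum_(0 <= i < n.+1) X i w)%N.

(* Main.v *)
Require Import Defs.
From mathcomp Require Import all_boot all_order all_algebra finmap zify.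
From mathcomp Require Import all_classical all_reals all_analysis.
From mathcomp Require Import measurable_realfun.

(** The randomness enters only through two almost sure properties of the
increments [x n = X n w].  Each value that is taken at all is taken infinitely
often ([iid_recurrent], by independence), and [49 * x n <= n ^ 2] for all large
[n] ([ae_eventually_le_square]): as [n ^ 2 < c * k] iff [n < sqrt (c * k)], the
probabilities of the events [n ^ 2 < c * X n] add up to at most
[E (sqrt (c * X 0)) + 1], which the moment hypothesis makes finite, and the
first Borel-Cantelli lemma applies.

The rest is a deterministic statement about the partial sums [W n]
([recurrent_asymptotically_complete]).  Whenever [x p.+1 = v], exchanging the
term [W p] for [W p.+1] raises a sum by [v]; by recurrence this can be done
arbitrarily late, for every value [v] of the sequence.  The gcd [d] of the
values is a difference of two sums of values ([bezout_sums]), so with enough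
such pairs of consecutive indices the sums of some of the terms include a
progression [b, b + d, .., b + L * d] for any prescribed [L]
([realizable_progression]).  The number [K] of indices used depends on [L]
alone, whereas their location can be pushed as far as one likes.

The remaining terms are then added one after the other: a term [W n] can be
added to a run of consecutive multiples of [d] without creating a hole as long
as [W n] is at most the length of the run ([greedy_subset_sum]), and the run
then grows by [W n].  For small [n] this holds by the choice of [L].  For large
[n], some index [u] with [n - 3 <= u < n] is not reserved for the pairs, so
[W n] exceeds [W u] by at most three increments, that is by at
most [3 * n ^ 2 / 49], while the terms before [u] add up to at least [u ^ 2 / 4],
because [W i > i] and the reserved indices are few and far out
([psum_leq_avoiding_sum]). *)

Set Implicit Arguments.
Unset Strict Implicit.
Unset Printing Implicit Defensive.

Import Order.TTheory GRing.Theory Num.Theory.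
Import numFieldNormedType.Exports.

(** * Subset sums and the greedy extension *)

Definition subset_sum (a : nat -> nat) (S : pred nat) (v : nat) : Prop :=
  exists2 F : {fset nat}, (forall i, i \in F -> S i) & v = (\sum_(i <- F) a i)%N.

Lemma subset_sum1 a (S : pred nat) i : S i -> subset_sum a S (a i).
Proof.
by move=> Si; exists [fset i]%fset; rewrite ?big_seq_fset1// => j /fset1P ->.
Qed.

Lemma subset_sumS a (S S' : pred nat) v :
  subpred S S' -> subset_sum a S v -> subset_sum a S' v.
Proof. by move=> SS' [F FS ->]; exists F => // i /FS /SS'. Qed.

Lemma subset_sumD a (S S' : pred nat) v v' :
  (forall i, S i -> ~~ S' i) ->
  subset_sum a S v -> subset_sum a S' v' -> subset_sum a (predU S S') (v + v').
Proof.
move=> dis [F FS ->] [F' FS' ->]; exists (F `|` F')%fset.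
  by move=> i /fsetUP[/FS|/FS'] /= ->; rewrite ?orbT.
rewrite -big_cat; apply: perm_big; rewrite perm_sym.
apply: uniq_perm => [||i]; last by rewrite mem_cat in_fsetU.
- by rewrite fset_uniq.
- rewrite cat_uniq !fset_uniq andbT /=; apply/hasPn => i /= /FS' S'i.
  by apply/negP => /FS /dis; rewrite S'i.
Qed.

Lemma dvdn_subset_sum a S d v :
  (forall i, d %| a i) -> subset_sum a S v -> d %| v.
Proof. by move=> da [F _ ->]; apply: dvdn_sum. Qed.

Lemma sum_nat_cond_recr (S : pred nat) (a : nat -> nat) n :
  \sum_(0 <= i < n.+1 | S i) a i =
  \sum_(0 <= i < n | S i) a i + (if S n then a n else 0).
Proof. by rewrite big_mkcond big_nat_recr//= -big_mkcond. Qed.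

(** Here [h] is the length of the initial run of multiples of [d] obtained from
the terms in [S].  A target beyond the current run falls back into it once
[a n] is subtracted, and stays nonnegative because [a n] does not exceed the
length of the run. *)
Lemma greedy_subset_sum a (S : pred nat) d b h :
  (forall i, d %| a i) ->
  (forall v, v <= h -> d %| v -> subset_sum a S (b + v)) ->
  (forall n, ~~ S n -> a n <= h + \sum_(0 <= i < n | ~~ S i) a i) ->
  forall n v, v <= h + \sum_(0 <= i < n | ~~ S i) a i -> d %| v ->
    subset_sum a [pred i | S i || (i < n)] (b + v).
Proof.
move=> da hS ha; elim=> [|n IHn] v.
  rewrite big_geq// addn0 => vh dv; apply: subset_sumS (hS _ vh dv).
  by move=> i /= ->.
have [Sn|Sn] := boolP (S n).
  rewrite sum_nat_cond_recr Sn addn0 => vh dv.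
  apply: subset_sumS (IHn _ vh dv) => i /= /orP[->//|/ltnW].
  by rewrite ltnS => ->; rewrite orbT.
rewrite sum_nat_cond_recr Sn => vh dv.
have [vle|vgt] := leqP v (h + \sum_(0 <= i < n | ~~ S i) a i).
  apply: subset_sumS (IHn _ vle dv) => i /= /orP[->//|/ltnW].
  by rewrite ltnS => ->; rewrite orbT.
have av : a n <= v by exact: leq_trans (ha _ Sn) (ltnW vgt).
rewrite -(subnK av) addnA.
apply: (@subset_sumS _ (predU [pred i | S i || (i < n)] (pred1 n))).
  by move=> i /=; case: (S i) => //=; lia.
apply: subset_sumD; last by apply: subset_sum1 => /=.
- by move=> i /= /orP[Si|]; [apply: contraNneq Sn => <-|rewrite ltn_neqAle => /andP[]].
- by apply: IHn; [rewrite leq_subLR; lia|rewrite dvdn_sub].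
Qed.

(** * Partial sums *)

Definition psum (x : nat -> nat) (n : nat) : nat := \sum_(0 <= i < n.+1) x i.

Lemma psumS x n : psum x n.+1 = psum x n + x n.+1.
Proof. by rewrite /psum big_nat_recr. Qed.

Lemma psum_gt x n : (forall i, 0 < x i) -> n < psum x n.
Proof.
move=> xp; elim: n => [|n IHn]; first by rewrite /psum big_nat1.
by have := xp n.+1; rewrite psumS; lia.
Qed.

Lemma leq_psum x m n : m <= n -> psum x m <= psum x n.
Proof.
elim: n => [|n IHn]; first by rewrite leqn0 => /eqP ->.
by rewrite leq_eqVlt => /orP[/eqP->//|/IHn]; rewrite psumS; lia.
Qed.

Lemma dvdn_psumP x e : (forall i, e %| psum x i) <-> (forall i, e %| x i).
Proof.
split=> [h [|i]|h i]; last exact: dvdn_sum.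
- by have := h 0; rewrite /psum big_nat1.
- by have := h i.+1; rewrite psumS dvdn_addr.
Qed.

(** * Arithmetic progressions from pairs of consecutive terms *)

Definition recurrent (x : nat -> nat) : Prop :=
  forall i N, exists2 p, N <= p & x p = x i.

(** The order of the quantifiers is the point: the number [K] of reserved indices
is fixed before the threshold [N] beyond which they lie, so that they can be made
negligible among the indices below any of them.  By the third
clause the reserved indices do not cluster, so that each term exceeds some free
term before it by at most three increments.  The offset [b] makes only the
differences between elements of [V] matter. *)
Definition realizable (x : nat -> nat) (V : nat -> Prop) : Prop :=
  exists K, forall N, exists M (S : pred nat) b,
    [/\ forall i, S i -> N <= i < M,
        forall u, \sum_(0 <= i < u) S i <= K,
        forall n, exists2 u, n <= u < n + 3 & ~~ S u
      & forall v, V v -> subset_sum (psum x) S (b + v)].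

Section Realizable.
Variable x : nat -> nat.

Lemma realizableS (V V' : nat -> Prop) :
  (forall v, V v -> V' v) -> realizable x V' -> realizable x V.
Proof.
move=> VV' [K h]; exists K => N; have [M [S [b [? ? ? hS]]]] := h N.
by exists M, S, b; split => // v /VV' /hS.
Qed.

Lemma realizable_shift c (V : nat -> Prop) :
  realizable x V -> realizable x (fun v => V (c + v)).
Proof.
move=> [K h]; exists K => N; have [M [S [b [? ? ? hS]]]] := h N.
by exists M, S, (b + c); split => // v Vv; rewrite -addnA; exact: hS.
Qed.

Lemma realizable0 : realizable x (fun v => v = 0).
Proof.
exists 0 => N; exists 0, pred0, 0; split=> //= [u|n|v ->].
- by rewrite big1.
- by exists n; lia.
- by exists fset0; rewrite ?big_seq_fset0.
Qed.

(** The second set of indices is placed after the first one with a free index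
[maxn N M] in between: a window of three indices either contains this free index
or meets only one of the two sets. *)
Lemma realizableD (V V' : nat -> Prop) :
  realizable x V -> realizable x V' ->
  realizable x (fun v => exists v1 v2, [/\ V v1, V' v2 & v = v1 + v2]).
Proof.
move=> [K h] [K' h']; exists (K + K') => N.
have [M [S [b [SM SK Sgap hS]]]] := h N.
have [M' [S' [b' [SM' SK' Sgap' hS']]]] := h' (maxn N M).+1.
exists (maxn M M'), (predU S S'), (b + b'); split=> [i /= /orP[/SM|/SM']|u|n|v].
- by lia.
- by lia.
- apply: leq_trans (leq_add (SK u) (SK' u)); rewrite -big_split/=.
  by apply: leq_sum => i _; case: (S i); case: (S' i).
- have [Mn|nM] := leqP (maxn N M) n.
    have [u nu S'u] := Sgap' n; exists u => //=; rewrite negb_or S'u andbT.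
    by apply/negP => /SM; lia.
  have [nM3|nM3] := ltnP (maxn N M) (n + 3).
    exists (maxn N M) => /=; first lia.
    by apply/norP; split; apply/negP; [move=> /SM|move=> /SM']; lia.
  have [u nu Su] := Sgap n; exists u => //=; rewrite negb_or Su/=.
  by apply/negP => /SM'; lia.
- move=> [v1 [v2 [Vv1 Vv2 ->]]]; rewrite addnACA; apply: subset_sumD; last exact: hS'.
  + by move=> i /SM Si; apply/negP => /SM'; lia.
  + exact: hS.
Qed.

(** The reserved pair is [p, p.+1] where [x p.+1 = x i]: one of [psum x p] and
[psum x p.+1] is selected. *)
Lemma realizable_step i :
  recurrent x -> realizable x (fun v => v = 0 \/ v = x i).
Proof.
move=> xrec; exists 2 => N; have [[//|p] Np xp] := xrec i N.+1.
exists p.+2, [pred j | (j == p) || (j == p.+1)], (psum x p).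
split=> [j /= /orP[/eqP->|/eqP->]|u|n|v [->|->]].
- by lia.
- by lia.
- suff -> : \sum_(0 <= j < u) [pred j | (j == p) || (j == p.+1)] j =
            (p < u) + (p.+1 < u) by lia.
  by elim: u => [|u IHu]; [rewrite big_geq|rewrite big_nat_recr//= IHu; lia].
- have [->|np] := eqVneq n p; first by exists p.+2 => /=; lia.
  have [->|np'] := eqVneq n p.+1; first by exists p.+2 => /=; lia.
  by exists n => /=; lia.
- by rewrite addn0; apply: subset_sum1; rewrite /= eqxx.
- by rewrite -xp -psumS; apply: subset_sum1; rewrite /= eqxx orbT.
Qed.

Lemma realizable_sum (s : seq nat) :
  recurrent x -> realizable x (fun v => v = 0 \/ v = \sum_(i <- s) x i).
Proof.
move=> xrec; elim: s => [|i s IHs].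
  by apply: realizableS realizable0 => v; rewrite big_nil => -[].
apply: realizableS (realizableD (realizable_step i xrec) IHs) => v [->|->].
  by exists 0, 0; split; [left|left|].
by exists (x i), (\sum_(j <- s) x j); rewrite big_cons; split; [right|right|].
Qed.

(** Selecting the lower terms for [s] and the upper ones for [t], or the other way
round, gives two sums that differ by [d]; [L] independent copies of this choice
give the progression. *)
Lemma realizable_progression (s t : seq nat) d L : recurrent x ->
  \sum_(i <- s) x i = \sum_(i <- t) x i + d ->
  realizable x (fun v => exists2 j, j <= L & v = j * d).
Proof.
move=> xrec std; elim: L => [|L IHL].
  by apply: realizableS realizable0 => v [j]; rewrite leqn0 => /eqP ->.
have r1 : realizable x (fun v => v = 0 \/ v = d).
  apply: realizableS (realizable_shift (\sum_(i <- t) x i)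
    (realizableD (realizable_sum s xrec) (realizable_sum t xrec))).
  move=> v [->|->].
    by exists 0, (\sum_(i <- t) x i); split; [left|right|rewrite addn0].
  by exists (\sum_(i <- s) x i), 0; split; [right|left|rewrite addn0].
apply: realizableS (realizableD IHL r1) => v [j jL ->].
have [jL'|Lj] := leqP j L.
  by exists (j * d), 0; split; [exists j|left|rewrite addn0].
have -> : j = L.+1 by lia.
by exists (L * d), d; split; [exists L|right|rewrite mulSn addnC].
Qed.

End Realizable.

(** The least positive difference of two sums of values divides each value, since
the remainder of a division is again such a difference. *)
Lemma bezout_sums (x : nat -> nat) : 0 < x 0 ->
  exists2 d, 0 < d & (forall i, d %| x i) /\
    exists s t : seq nat, \sum_(i <- s) x i = \sum_(i <- t) x i + d.
Proof.
move=> x0.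
pose Q d := exists s t : seq nat, \sum_(i <- s) x i = \sum_(i <- t) x i + d.
have exP : exists d, `[< 0 < d /\ Q d >].
  exists (x 0); apply/asboolP; split=> //.
  by exists [:: 0], [::]; rewrite big_seq1 big_nil.
have [d /asboolP[d0 Qd] dmin] := ex_minnP exP.
exists d => //; split=> // i; rewrite /dvdn -leqn0 leqNgt; apply/negP => r0.
have : d <= x i %% d; last by rewrite leqNgt ltn_pmod.
apply: dmin; apply/asboolP; split=> //.
case: Qd => s [t std]; set q := x i %/ d.
have copies u : \sum_(j <- flatten (nseq q u)) x j = q * \sum_(j <- u) x j.
  elim: q => [|q IHq]; first by rewrite big_nil.
  by rewrite /= big_cat IHq mulSn.
(* [x i + q * sum_t = q * sum_s + x i %% d], as [sum_s = sum_t + d] *)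
exists (i :: flatten (nseq q t)), (flatten (nseq q s)).
by rewrite big_cons !copies std mulnDr {1}(divn_eq (x i) d) -/q; lia.
Qed.

(** * Quadratic growth beats the increments *)

(** Without [S] the sum is at least [1 + .. + u]; each of the elements of [S] below
[u] costs at most [u], and there are at most [u / 4] of them: none below [N],
and no more than [K <= N / 4] in all. *)
Lemma sum_avoiding_ge (a : nat -> nat) (S : pred nat) K N u :
  (forall i, i < a i) -> (forall i, S i -> N <= i) ->
  (forall u, \sum_(0 <= i < u) S i <= K) -> 4 * K <= N ->
  u * u <= 4 * \sum_(0 <= i < u | ~~ S i) a i.
Proof.
move=> ai SN SK KN.
have few : 4 * \sum_(0 <= i < u) S i <= u.
  have [uN|/ltnW Nu] := leqP u N; last by have := SK u; lia.
  rewrite big_nat big1// => i /andP[_ iu]; apply/eqP; rewrite eqb0.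
  by apply/negP => /SN; lia.
have tri : u * u <= 2 * \sum_(0 <= i < u) i.+1.
  elim: u {few} => [//|u IHu]; rewrite big_nat_recr//=; nia.
have : \sum_(0 <= i < u) i.+1 <=
       \sum_(0 <= i < u | ~~ S i) a i + (\sum_(0 <= i < u) S i) * u.
  rewrite [X in X + _]big_mkcond big_distrl -big_split/= big_nat [leqRHS]big_nat.
  apply: leq_sum => i /andP[_ iu]; have := ai i.
  by case: (S i) => /=; lia.
nia.
Qed.

(** With [u] outside [S] and [n - 3 <= u < n], the inequality reduces to [3 * n ^ 2 / 49 <= u ^ 2 / 4]. As [u >= n / 2] for [n >= 6], it suffices that
[3 / 49 <= 1 / 16], which is where the constant [49] comes from. *)
Lemma psum_leq_avoiding_sum (x : nat -> nat) (S : pred nat) K N n0 n :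
  (forall i, 0 < x i) ->
  (forall m, n0 <= m -> 49 * x m <= m * m) ->
  (forall i, S i -> N <= i) ->
  (forall u, \sum_(0 <= i < u) S i <= K) -> 4 * K <= N ->
  (forall m, exists2 u, m <= u < m + 3 & ~~ S u) ->
  n0 + 6 <= n ->
  psum x n <= \sum_(0 <= i < n | ~~ S i) psum x i.
Proof.
move=> xp xle SN SK KN Sgap n0n.
have [u nu Su] := Sgap (n - 3).
have un : u < n by lia.
have Wn : 49 * psum x n <= 49 * psum x u + 3 * (n * n).
  have xn m : n - 3 < m -> m <= n -> 49 * x m <= n * n.
    by move=> ? ?; apply: leq_trans (xle m _) _; [lia|nia].
  have [v nE] : exists v, n = v.+3 by exists (n - 3); lia.
  have h1 := xn n; have h2 := xn n.-1; have h3 := xn n.-2.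
  have : u = v \/ u = v.+1 \/ u = v.+2 by lia.
  rewrite nE !psumS /= in h1 h2 h3 *.
  by case=> [->|[->|->]]; rewrite ?psumS; lia.
have sumu := sum_avoiding_ge u (fun i => psum_gt i xp) SN SK KN.
have : psum x u + \sum_(0 <= i < u | ~~ S i) psum x i <=
       \sum_(0 <= i < n | ~~ S i) psum x i.
  rewrite [leqRHS](big_cat_nat (n := u.+1))//= sum_nat_cond_recr Su; lia.
nia.
Qed.

(** The length [L * d] of the progression takes care of the terms of index at most
[n0 + 6], and [psum_leq_avoiding_sum] of the later ones. *)
Lemma recurrent_asymptotically_complete (x : nat -> nat) n0 :
  (forall i, 0 < x i) -> recurrent x ->
  (forall n, n0 <= n -> 49 * x n <= n * n) ->
  asymptotically_complete (psum x).
Proof.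
move=> xp xrec xle; split; first exact: leq_psum.
  by move=> i; apply: leq_ltn_trans (psum_gt i xp).
have [d d0 [dx [s [t st]]]] := bezout_sums (xp 0).
have dW : forall i, d %| psum x i by apply/dvdn_psumP.
exists d.
  split=> // e /dvdn_psumP ex.
  by rewrite -(dvdn_addr (m := \sum_(i <- t) x i) d) -?st; apply: dvdn_sum.
pose L := psum x (n0 + 6).
have [K hK] := realizable_progression L xrec st.
have [M [S [b [SM SK Sgap hS]]]] := hK (4 * K + n0 + 6).
have db : d %| b.
  have /dvdn_subset_sum : subset_sum (psum x) S (b + 0) by apply: hS; exists 0.
  by rewrite addn0; apply.
have SN i : S i -> 4 * K + n0 + 6 <= i by move/SM/andP => [].
exists b.+1 => // n bn.
have bnd : b <= n * d by rewrite (leq_trans (ltnW bn))// leq_pmulr.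
pose v := n * d - b.
have dv : d %| v by rewrite dvdn_sub// dvdn_mull.
have big m : m * m <= 4 * \sum_(0 <= i < m | ~~ S i) psum x i.
  by apply: (@sum_avoiding_ge _ _ K (4 * K + n0 + 6)) => //; [move=> i; exact: psum_gt|lia].
(* The run has length at least [u ^ 2 / 4] after [u] steps; [u = 4 * v] is enough. *)
have [F _ ndE] : subset_sum (psum x) [pred i | S i || (i < 4 * v)] (b + v).
  apply: (@greedy_subset_sum _ _ d b (L * d)) => //.
  - by move=> w wL /dvdnP[j wE]; apply: hS; exists j => //; rewrite wE leq_pmul2r in wL.
  - move=> m Sm; have [mn|nm] := leqP m (n0 + 6).
      apply: leq_trans (leq_addr _ _).
      by apply: leq_trans (leq_psum x mn) _; rewrite leq_pmulr.
    apply: leq_trans (leq_addl _ _).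
    by apply: (@psum_leq_avoiding_sum _ _ K (4 * K + n0 + 6) n0) => //; lia.
  - by have := big (4 * v); nia.
by exists F; rewrite -ndE subnKC.
Qed.

(** * Almost sure properties of the increments *)

Local Open Scope classical_set_scope.
Local Open Scope ring_scope.

Section Probability.
Context (d : measure_display) (T : measurableType d) (R : realType).
Context (P : probability T R).

Lemma RV_preimage_measurable (Z : {RV P >-> nat}) (B : set nat) :
  measurable (Z @^-1` B).
Proof. by apply: measurable_funPTI. Qed.

(** By independence the probability of avoiding [k] over [m] successive times is
[q ^ m], with [q < 1] the probability that [X 0] differs from [k]. *)
Lemma iid_avoid_eq0 (X : nat -> {RV P >-> nat}) (k N : nat) :
  mutually_independent X -> identically_distributed X ->
  P (X 0%N @^-1` [set k]) != 0%E ->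
  P (\bigcap_(p in [set p | (N <= p)%N]) X p @^-1` [set~ k]) = 0%E.
Proof.
move=> indep iid Pk.
set A := \bigcap_(p in _) _.
have mX i B : measurable (X i @^-1` B) := RV_preimage_measurable (X i) B.
have mA : measurable A by apply: bigcap_measurable => //; exists N => /=.
pose q : R := fine (P (X 0%N @^-1` [set~ k])).
have qE j : P (X j @^-1` [set~ k]) = q%:E.
  by rewrite fineK ?fin_num_measure//; exact: (iid j 0%N).
have q0 : 0 <= q by rewrite fine_ge0.
have q1 : q < 1.
  rewrite -lte_fin -(qE 0%N) -preimage_setC probability_setC//.
  rewrite -(fineK (fin_num_measure P _ (mX 0%N [set k]))) -EFinB lte_fin.
  rewrite ltrBlDr ltrDl fine_gt0// lt0e Pk measure_ge0/=.
  exact: le_lt_trans (probability_le1 P (mX _ _)) (ltry 1).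
have Aq m : (P A <= (q ^+ m)%:E)%E.
  pose J := [fset j | j in index_iota N (N + m)]%fset.
  have := @indep J (fun=> [set~ k]) (fun=> Logic.I).
  have -> : (\prod_(j <- J) P (X j @^-1` [set~ k]) = (q ^+ m)%:E)%E.
    rewrite (eq_bigr (fun=> q%:E))// prodEFin; congr EFin.
    rewrite (perm_big (index_iota N (N + m))) ?prodr_const_nat ?addKn//.
    apply: uniq_perm => [||i]; rewrite ?fset_uniq ?iota_uniq//.
    by rewrite in_fset.
  move=> <-; apply: le_measure; rewrite ?inE//.
    by apply: fin_bigcap_measurable.
  move=> w Aw j /= Jj; apply: Aw => /=.
  by move: Jj; rewrite in_fset mem_index_iota => /andP[].
apply/eqP; rewrite eq_le measure_ge0 andbT leNgt; apply/negP => PA.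
have finPA : P A \is a fin_num by exact: fin_num_measure.
have r0 : 0 < fine (P A) by rewrite -lte_fin fineK.
have : `|q| < 1 by rewrite ger0_norm.
move=> /cvg_expr /cvgr0_norm_lt /(_ _ r0)[m _ /(_ m (leqnn m))].
rewrite ger0_norm ?exprn_ge0// => qm.
by have := Aq m; rewrite -(fineK finPA) lee_fin leNgt qm.
Qed.

(** Only countably many values, positions and thresholds occur, so each may be
treated separately: a value of probability zero is almost surely never taken,
and the others cannot be avoided forever. *)
Lemma iid_recurrent (X : nat -> {RV P >-> nat}) :
  mutually_independent X -> identically_distributed X ->
  {ae P, forall w, recurrent (X ^~ w)}.
Proof.
move=> indep iid.
suff : {ae P, forall w, forall k i N, X i w = k -> exists2 p, (N <= p)%N & X p w = k}.
  by apply: filterS => w h i N; exact: h.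
apply: ae_foralln => k; apply: ae_foralln => i; apply: ae_foralln => N.
have mX j B : measurable (X j @^-1` B) := RV_preimage_measurable (X j) B.
have [Pk|Pk] := eqVneq (P (X 0%N @^-1` [set k])) 0%E.
  exists (X i @^-1` [set k]); split=> //; first by rewrite -Pk; exact: (iid i 0%N).
  by move=> w /=; apply: contra_notP => Xk /Xk.
exists (\bigcap_(p in [set p | (N <= p)%N]) X p @^-1` [set~ k]); split.
- by apply: bigcap_measurable => //; exists N => /=.
- exact: iid_avoid_eq0.
- move=> w /= h p Np Xp; apply: h => _; by exists p.
Qed.

(** There are at most [y + 1] natural numbers below [y]. *)
Lemma nneseries_indic_lt (y : R) : 0 <= y ->
  (\sum_(0 <= n <oo) (n%:R < y)%R%:R%:E <= (y + 1)%:E)%E.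
Proof.
move=> y0; apply: lime_le; first by apply: is_cvg_nneseries => n _ _; rewrite lee_fin.
apply: nearW => N; rewrite sumEFin lee_fin.
suff : \sum_(0 <= i < N) (i%:R < y)%R%:R <= N%:R :> R /\
       \sum_(0 <= i < N) (i%:R < y)%R%:R <= y + 1 by case.
elim: N => [|N [IH1 IH2]]; first by rewrite big_geq// addr_ge0.
rewrite big_nat_recr//=; split; first by rewrite -natr1 lerD//; case: (_ < _).
by case: ltP => Ny; rewrite ?addr0// lerD// (le_trans IH1)// ltW.
Qed.

(** Borel-Cantelli for the events [n ^ 2 < c * X n]: by identical distribution
[X n] may be replaced by [X 0], and then [nneseries_indic_lt] bounds the number of
[n] for which the event holds by [sqrt (c * X 0) + 1], which is integrable. *)
Lemma ae_eventually_le_square (X : nat -> {RV P >-> nat}) (c : nat) :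
  identically_distributed X ->
  ('E_P[fun w => ((X 0%N w)%:R `^ 2^-1)%R] < +oo)%E ->
  {ae P, forall w, exists n0, forall n, (n0 <= n)%N -> (c * X n w <= n * n)%N}.
Proof.
move=> iid; rewrite unlock => moment.
have mX i B : measurable (X i @^-1` B) := RV_preimage_measurable (X i) B.
have mfX (g : nat -> \bar R) : measurable_fun setT (fun w => g (X 0%N w)).
  by move=> _ B _; rewrite setTI comp_preimage; exact: mX.
pose F n := X n @^-1` [set k | (n * n < c * k)%N].
pose y w : R := (c * X 0 w)%N%:R `^ 2^-1.
pose s : R := c%:R `^ 2^-1.
pose Y w : R := (X 0%N w)%:R `^ 2^-1.
have y0 w : 0 <= y w by exact: powR_ge0.
have FE n : P (F n) = (\int[P]_w ((n%:R < y w)%R%:R : R)%:E)%E.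
  have -> : P (F n) = P (X 0%N @^-1` [set k | (n * n < c * k)%N]) by exact: (iid n 0%N).
  rewrite -[X in P X]setIT -integral_indic//; apply: eq_integral => w _.
  rewrite indicE /y powR12_sqrt//; congr (_%:R%:E).
  rewrite -(ltr_pXn2r (n := 2))// ?nnegrE ?sqrtr_ge0// sqr_sqrtr// -natrX ltr_nat.
  by rewrite mem_setE/= mulnn.
have mlt n : measurable_fun setT (fun w => ((n%:R < y w)%R%:R : R)%:E).
  exact: (mfX (fun k => (n%:R < (c * k)%N%:R `^ 2^-1 :> R)%R%:R%:E)).
have : P (lim_sup_set F) = 0%E.
  apply: lim_sup_set_cvg0 => [n|]; first exact: mX.
  rewrite (eq_eseriesr (fun n _ => FE n)) -integral_nneseries//.
  have m2 : measurable_fun setT (fun w => (s%:E * (Y w)%:E)%E).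
    exact: (mfX (fun k => (s%:E * (k%:R `^ 2^-1)%:E)%E)).
  have m1 : measurable_fun setT (fun w => (Y w)%:E).
    exact: (mfX (fun k => (k%:R `^ 2^-1)%:E)).
  have yE w : (y w + 1)%:E = (s%:E * (Y w)%:E + 1)%E.
    by rewrite /y natrM powRM// EFinD EFinM.
  apply: (@le_lt_trans _ _ (\int[P]_w (y w + 1)%:E)%E).
    apply: ge0_le_integral => //.
    - by move=> w _; apply: nneseries_ge0 => n _ _; rewrite lee_fin.
    - exact: ge0_emeasurable_sum.
    - by apply: (mfX (fun k => ((c * k)%N%:R `^ 2^-1 + 1 : R)%:E)).
    - by move=> w _; exact: nneseries_indic_lt.
  under eq_integral do rewrite yE.
  rewrite ge0_integralD//; last by move=> w _; rewrite mule_ge0// lee_fin powR_ge0.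
  rewrite ge0_integralZl//; last 2 first.
    by move=> w _; rewrite lee_fin powR_ge0.
    by rewrite lee_fin powR_ge0.
  rewrite integral_cst// mul1e lte_add_pinfty//.
    by rewrite lte_mul_pinfty// lee_fin powR_ge0.
  exact: le_lt_trans (probability_le1 P measurableT) (ltry 1).
move=> supF0; exists (lim_sup_set F); split=> //.
  by apply: bigcapT_measurable => n; apply: bigcup_measurable => j _; exact: mX.
move=> w /= h n _; apply: contra_notP h => h; exists n => m nm.
rewrite leqNgt; apply/negP => Fm; apply: h; by exists m.
Qed.

End Probability.

Theorem theorem1p2 (d : measure_display) (T : measurableType d) (R : realType)
    (P : probability T R) (X : nat -> {RV P >-> nat})
    (Xpos : forall i w, (0 < X i w)%N)
    (Xindep : mutually_independent X)
    (Xid : identically_distributed X)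
    (Xmoment : ('E_P[fun w => ((X 0%N w)%:R `^ 2^-1)%R] < +oo)%E) :
  {ae P, forall w, asymptotically_complete (partial_sum X ^~ w)}.
Proof.
apply: filterS2 (iid_recurrent Xindep Xid) (ae_eventually_le_square 49 Xid Xmoment).
move=> w Xrec [n0 Xle].
exact: (@recurrent_asymptotically_complete (X ^~ w) n0).
Qed.
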